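(* Let $N \geq 1$ and $0 \leq M < N$ be integers, let $\lambda(t) > 0$, and let $\mathbf{X}_t = \sum_{i=1}^N X_t^i \geq 0$ be the (deterministic) sum of the measurements $X_t^1,\dots,X_t^N$ of $N$ users in time slot $t$. Each user $i$ releases $\hat{X}_t^i = X_t^i + \mathcal{G}_1^{(i)} - \mathcal{G}_2^{(i)}$, where the $2N$ random variables $\mathcal{G}_1^{(1)},\mathcal{G}_2^{(1)},\dots,\mathcal{G}_1^{(N)},\mathcal{G}_2^{(N)}$ are mutually independent and each is distributed as $\mathcal{G}(N-M,\lambda(t))$. Let $\hat{\mathbf{X}}_t = \sum_{i=1}^N \hat{X}_t^i$, $\delta_t = \frac{|\mathbf{X}_t - \hat{\mathbf{X}}_t|}{\mathbf{X}_t + 1}$, $\mu(t) = \mathbb{E}(\delta_t)$ and $\sigma(t) = \sqrt{\mathit{Var}(\delta_t)}$. Let $\alpha = M/N$ (so $\alpha<1$). Then $$\mu(t) \leq \frac{2}{B(1/2,\frac{1}{1-\alpha})} \cdot \frac{\lambda(t)}{\mathbf{X}_t + 1}$$ and $$\sigma(t) \leq \sqrt{\frac{2}{1-\alpha} - \frac{4}{B(1/2,\frac{1}{1-\alpha})^2}} \cdot \frac{\lambda(t)}{\mathbf{X}_t + 1},$$ where $B(x,y) = \frac{\Gamma(x)\Gamma(y)}{\Gamma(x+y)}$ is the beta function.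
   Context: For real $n>0$ and $\lambda>0$, $\mathcal{G}(n,\lambda)$ denotes the gamma distribution with probability density $g(x,n,\lambda) = \frac{(1/\lambda)^{1/n}}{\Gamma(1/n)} x^{\frac{1}{n}-1} e^{-x/\lambda}$ for $x \geq 0$ (i.e., shape parameter $1/n$ and scale parameter $\lambda$). Expectation and variance are taken over the randomness of the gamma noise. *)

(* Defs.v *)
From HB Require Import structures.
From mathcomp Require Import all_boot all_order all_algebra.
From mathcomp Require Import all_classical all_reals all_analysis.
Set Implicit Arguments. Unset Strict Implicit. Unset Printing Implicit Defensive.
Import Order.TTheory GRing.Theory Num.Theory.
Local Open Scope classical_set_scope.
Local Open Scope ring_scope.

Definition Gamma {R : realType} (s : R) : R :=
  fine (\int[@lebesgue_measure R]_(x in `]0%R, +oo[%classic)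
          (powR x (s - 1) * expR (- x))%:E)%E.

Definition Beta {R : realType} (x y : R) : R := Gamma x * Gamma y / Gamma (x + y).

(* Density of the gamma distribution G(n, lam): shape 1/n, scale lam. *)
Definition gamma_pdf {R : realType} (n lam : R) (x : R) : R :=
  powR (1 / lam) (1 / n) / Gamma (1 / n) * powR x (1 / n - 1) * expR (- x / lam).

Definition gamma_distributed {d} {T : measurableType d} {R : realType}
    (P : probability T R) (n lam : R) (X : T -> R) : Prop :=
  forall A : set R, measurable A ->
    P (X @^-1` A) =
    (\int[@lebesgue_measure R]_(x in A `&` `[0%R, +oo[%classic)
        (gamma_pdf n lam x)%:E)%E.

Definition mutually_independent {d} {T : measurableType d} {R : realType}
    (P : probability T R) {I : finType} (X : I -> T -> R) : Prop :=
  forall (J : {set I}) (A : I -> set R), (forall i, measurable (A i)) ->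
    fine (P (\bigcap_(i in [set` J]) (X i @^-1` A i))) =
    \prod_(i in J) fine (P (X i @^-1` A i)).

(* Main.v *)
(* The reported total differs from the true one by [V - U], where [U] and [V] are
   independent sums of [N] gamma variables of shape [1 / (N - M)], hence two
   independent gamma variables of shape [a = N / (N - M) = 1 / (1 - alpha)] and
   scale [lam]. In the coordinates [z = x + y], [u = x / (x + y)] the joint density
   of two gamma variables splits into a gamma factor in [z] and a beta factor in
   [u]; this gives the convolution rule, the Gamma-Beta relation, and, as [|x - y|]
   is [z * |2 u - 1|], the moments of [|U - V|]. The integrals in [u] are reduced
   to [Beta (1 / 2) a] by the substitution [t = (2 u - 1) ^ 2]. The result is
   [E |U - V| = 2 lam / Beta (1 / 2) a] and [E (U - V) ^ 2 = 2 a lam ^ 2], so both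
   bounds of the theorem are equalities. *)
Require Import Defs.
From HB Require Import structures.
From mathcomp Require Import all_boot all_order all_algebra.
From mathcomp Require Import all_classical all_reals all_analysis.
From mathcomp Require Import measurable_realfun ring lra.
Import Order.TTheory GRing.Theory Num.Theory.
Import numFieldNormedType.Exports.
Local Open Scope classical_set_scope.
Local Open Scope ring_scope.

(** Everything up to the values of the masses is done with nonnegative integrals in the extended
    reals, where Tonelli and changes of variables need no integrability. The Gamma-Beta relation is
    therefore proved as an identity of products before any factor is known to be finite. Finiteness
    cannot be skipped afterwards, because [Gamma] is defined through [fine], which would turn an
    infinite integral into 0. It follows from the same relation: its case [b = 1] is the recurrence
    of Gamma, obtained without integration by parts, and the recurrence carries a bound on []0, 1]]
    to all shapes. Two further obstacles shape the proof. The integrands [u ^ (a - 1)] and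
    [t ^ (- 1 / 2)] can be unbounded at the ends of the interval, so substitution is needed on open
    intervals. And mutual independence speaks of single variables only, so the independence of the
    two sums [U] and [V] has to be built up by adding one variable at a time. *)

Section affine_change_of_variables.
Context {R : realType}.
Local Open Scope ereal_scope.
Local Notation mu := (@lebesgue_measure R).

(** The image of Lebesgue measure under a translation gives each interval its own length, so by
    uniqueness it is Lebesgue measure. The dilation below is treated alike, with the factor [c] put
    on the image measure. *)
Lemma ge0_integral_translate (c : R) (f : R -> \bar R) :
  measurable_fun [set: R] f -> (forall x, 0 <= f x) ->
  \int[mu]_x f (x + c)%R = \int[mu]_x f x.
Proof.
move=> mf f0.
have mphi : measurable_fun [set: R] (fun x : R => (x + c)%R : measurableTypeR R).
  by apply: measurable_funD.
transitivity (\int[pushforward mu (fun x : R => (x + c)%R : measurableTypeR R)]_x f x).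
  by rewrite ge0_integral_pushforward.
apply: eq_measure_integral => A mA _ /=; apply/esym.
apply: lebesgue_measure_unique => // _ [[a b]] _ <- /=.
rewrite /pushforward.
have -> : (fun x : R => (x + c)%R) @^-1` `]a, b] = `](a - c)%R, (b - c)%R]%classic.
  by apply/seteqP; split => x /=; rewrite !in_itv/= ltrBlDr lerBrDr.
rewrite !lebesgue_measure_itv/= !lte_fin ltrD2r; case: ifP => // _.
by rewrite -!EFinB; congr EFin; ring.
Qed.

Lemma ge0_integral_dilate (c : R) (f : R -> \bar R) : (0 < c)%R ->
  measurable_fun [set: R] f -> (forall x, 0 <= f x) ->
  c%:E * \int[mu]_x f (c * x)%R = \int[mu]_x f x.
Proof.
move=> c0 mf f0.
have mphi : measurable_fun [set: R] (fun x : R => (c * x)%R : measurableTypeR R).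
  by apply: measurable_funM.
have -> : \int[mu]_x f (c * x)%R =
    \int[pushforward mu (fun x : R => (c * x)%R : measurableTypeR R)]_x f x.
  by rewrite ge0_integral_pushforward.
pose k := NngNum (ltW c0).
rewrite -[c]/(k%:num) -ge0_integral_mscale//.
apply: eq_measure_integral => A mA _ /=; apply/esym.
apply: lebesgue_measure_unique => // _ [[a b]] _ <- /=.
rewrite /mscale/= /pushforward.
have -> : (fun x : R => (c * x)%R) @^-1` `]a, b] = `](a / c)%R, (b / c)%R]%classic.
  by apply/seteqP; split => x /=; rewrite !in_itv/= ltr_pdivrMr// ler_pdivlMr// mulrC.
rewrite !lebesgue_measure_itv/= !lte_fin ltr_pM2r ?invr_gt0//; case: ifP => // _.
  by rewrite -!EFinB -EFinM; congr EFin; field; rewrite gt_eqF.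
by rewrite mule0.
Qed.

End affine_change_of_variables.

(** * Gamma and beta kernels, and the coordinates [(z, u)] *)

Section gamma_beta_kernels.
Context {R : realType}.
Implicit Types (lam a b x u z : R).
Local Notation mu := (@lebesgue_measure R).

(** Extended by zero to the whole line, like [beta_ker], so that translations and dilations never
    change a domain of integration. *)
Definition gamma_ker lam a x : R :=
  if 0 < x then x `^ (a - 1) * expR (- x / lam) else 0.

Definition beta_ker a b u : R :=
  if (0 < u) && (u < 1) then u `^ (a - 1) * (1 - u) `^ (b - 1) else 0.

Definition gamma_mass lam a : \bar R := (\int[mu]_x (gamma_ker lam a x)%:E)%E.

Definition beta_mass a b : \bar R := (\int[mu]_u (beta_ker a b u)%:E)%E.

Lemma gamma_ker_ge0 lam a x : 0 <= gamma_ker lam a x.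
Proof. by rewrite /gamma_ker; case: ifP => // _; rewrite mulr_ge0 ?powR_ge0 ?expR_ge0. Qed.

Lemma beta_ker_ge0 a b u : 0 <= beta_ker a b u.
Proof. by rewrite /beta_ker; case: ifP => // _; rewrite mulr_ge0 ?powR_ge0. Qed.

Lemma measurable_gamma_ker lam a : measurable_fun [set: R] (gamma_ker lam a).
Proof.
apply: measurable_fun_ifT => //; first exact: measurable_fun_ltr.
apply: measurable_funM; first exact: measurableT_comp (measurable_powR _) _.
apply: measurableT_comp => //; exact: measurable_funM.
Qed.

Lemma measurable_beta_ker a b : measurable_fun [set: R] (beta_ker a b).
Proof.
apply: measurable_fun_ifT => //.
  by apply: measurable_and; exact: measurable_fun_ltr.
apply: measurable_funM; first exact: measurableT_comp (measurable_powR _) _.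
apply: measurableT_comp (measurable_powR _) _ => //.
exact: measurable_funB.
Qed.

Lemma gamma_mass_ge0 lam a : (0 <= gamma_mass lam a)%E.
Proof. by apply: integral_ge0 => x _; rewrite lee_fin gamma_ker_ge0. Qed.

Lemma beta_mass_ge0 a b : (0 <= beta_mass a b)%E.
Proof. by apply: integral_ge0 => x _; rewrite lee_fin beta_ker_ge0. Qed.

(** The leading [z] is the Jacobian of [x = z * u]; it lifts the exponent [(a - 1) + (b - 1)] to
    [a + b - 1]. The exponentials merge because [z * u] and [z * (1 - u)] add up to [z]. *)
Lemma gamma_ker_dilate lam a b z u : 0 < z ->
  z * (gamma_ker lam a (z * u) * gamma_ker lam b (z - z * u)) =
  gamma_ker lam (a + b) z * beta_ker a b u.
Proof.
move=> z0; rewrite /gamma_ker /beta_ker z0 pmulr_rgt0//.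
have -> : z - z * u = z * (1 - u) by ring.
rewrite pmulr_rgt0// subr_gt0.
case: ltP => u0; last by rewrite !mul0r !mulr0.
case: ltP => u1 /=; last by rewrite !mulr0.
rewrite !powRM ?(ltW z0) ?(ltW u0) ?subr_ge0 ?(ltW u1)//.
have -> : z `^ (a + b - 1) = z * z `^ (a - 1) * z `^ (b - 1).
  rewrite -{2}(powRr1 (ltW z0)) -!powRD ?(gt_eqF z0) ?implybT//.
  by congr (_ `^ _); ring.
have -> : - z / lam = (- (z * u) / lam) + (- (z * (1 - u)) / lam) by ring.
by rewrite expRD; ring.
Qed.

(** The weight [H] is arbitrary so that one change of variables serves the convolution rule, the
    Gamma-Beta relation and both moments. No planar Jacobian is involved: a translation in [y], an
    exchange of integrals and a dilation in [x] suffice. *)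
Lemma gamma_ker_polar lam a b (H : R * R -> \bar R) :
  measurable_fun [set: R * R] H -> (forall p, 0 <= H p)%E ->
  (\int[mu]_x \int[mu]_y ((gamma_ker lam a x * gamma_ker lam b y)%:E * H (x, y)) =
   \int[mu]_z ((gamma_ker lam (a + b) z)%:E *
     \int[mu]_u ((beta_ker a b u)%:E * H (z * u, z * (1 - u))%R)))%E.
Proof.
move=> mH H0.
pose F (p : R * R) : \bar R :=
  ((gamma_ker lam a p.1 * gamma_ker lam b (p.2 - p.1))%:E * H (p.1, (p.2 - p.1)%R))%E.
have mp : measurable_fun [set: R * R] (fun p : R * R => (p.1, p.2 - p.1)).
  by apply: measurable_fun_pair => //; exact: measurable_funB.
have mF : measurable_fun [set: R * R] F.
  apply: emeasurable_funM; last exact: measurableT_comp mH mp.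
  apply/measurable_EFinP/measurable_funM.
    exact: measurableT_comp (measurable_gamma_ker _ _) _.
  apply: measurableT_comp (measurable_gamma_ker _ _) _ => //.
  exact: measurable_funB.
have F0 p : (0 <= F p)%E by rewrite mule_ge0// lee_fin mulr_ge0// gamma_ker_ge0.
transitivity (\int[mu]_x \int[mu]_z F (x, z))%E.
  apply: eq_integral => x _.
  rewrite -(@ge0_integral_translate _ (- x))//.
    apply/emeasurable_funM; last exact: measurableT_comp mH _.
    by apply/measurable_EFinP/measurable_funM => //; exact: measurable_gamma_ker.
  by move=> y; rewrite mule_ge0// lee_fin mulr_ge0// gamma_ker_ge0.
rewrite (fubini_tonelli (m1 := mu) (m2 := mu) F)//.
apply: eq_integral => z _.
have mFz : measurable_fun [set: R] (fun x => F (x, z)) by exact: measurableT_comp mF _.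
have mHz : measurable_fun [set: R] (fun u => H (z * u, z * (1 - u))).
  apply: measurableT_comp mH _.
  apply: measurable_fun_pair; apply: measurable_funM => //.
  exact: measurable_funB.
(* For [z <= 0], [x] and [z - x] are never both positive, so both sides vanish; for [z > 0] the
   dilation [x = z * u] is available. *)
have [z0|z0] := ltP 0 z; last first.
  rewrite {1}/gamma_ker ltNge z0/= mul0e.
  rewrite integral0_eq// => x _; rewrite /F/= /gamma_ker.
  case: ltP => x0; last by rewrite mul0r mul0e.
  rewrite subr_gt0; case: ltP => xz; last by rewrite mulr0 mul0e.
  by have := lt_le_trans (lt_trans x0 xz) z0; rewrite ltxx.
rewrite -(@ge0_integral_dilate _ z (fun x => F (x, z)))// -ge0_integralZl//.
- rewrite -ge0_integralZl//.
  + apply: eq_integral => u _.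
    rewrite muleA -!EFinM /F/= !muleA -!EFinM gamma_ker_dilate//.
    by congr (_ * H (_, _))%E; ring.
  + apply: emeasurable_funM => //; apply/measurable_EFinP.
    exact: measurable_beta_ker.
  + by move=> u _; rewrite mule_ge0// lee_fin beta_ker_ge0.
  + by rewrite lee_fin gamma_ker_ge0.
- by apply: measurableT_comp mFz _; apply: measurable_funM.
- by rewrite lee_fin ltW.
Qed.

End gamma_beta_kernels.

(** * Reflection, and substitution for integrands singular at the endpoints *)

Section substitution_on_open_intervals.
Context {R : realType}.
Local Notation mu := (@lebesgue_measure R).

Lemma ge0_integral_reflect (c : R) (f : R -> \bar R) :
  measurable_fun [set: R] f -> (forall x, 0 <= f x)%E ->
  (\int[mu]_x f (c - x)%R = \int[mu]_x f x)%E.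
Proof.
move=> mf f0; rewrite -[RHS](ge0_integral_translate c)//.
have mfc : measurable_fun [set: R] (fun x => f (x + c)).
  by apply: measurableT_comp mf _; apply: measurable_funD.
transitivity (\int[pushforward mu (-%R : _ -> measurableTypeR R)]_x f (x + c)%R)%E.
  rewrite ge0_integral_pushforward//=.
  by apply: eq_integral => x _; rewrite /= addrC.
by apply: eq_measure_integral => //= A mA AS; exact: lebesgue_measureN.
Qed.

Lemma bigcup_itv_shrink (s t : R^nat) (a b : R) :
  s n @[n --> \oo] --> a -> t n @[n --> \oo] --> b ->
  (forall n, a < s n) -> (forall n, t n < b) ->
  \bigcup_n `[s n, t n]%classic = `]a, b[%classic.
Proof.
move=> sa tb as_ tb_; apply/seteqP; split => [x [n _]|x] /=; rewrite !in_itv/=.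
  by move=> /andP[sx xt]; rewrite (lt_le_trans (as_ n))//= (le_lt_trans xt).
move=> /andP[ax xb].
have : \forall n \near \oo, s n < x /\ x < t n.
  near=> n; split; near: n.
  - exact: (cvgr_lt a).
  - exact: (cvgr_gt b).
case=> n _ /(_ n (leqnn n))[sx xt].
by exists n => //=; rewrite in_itv/= !ltW.
Unshelve. all: by end_near. Qed.

(** Continuity of [G] and [dphi] is asked only inside the interval, since the kernels may blow up at
    its ends. The formula on closed subintervals passes to the limit by monotone convergence on both
    sides. *)
Lemma ge0_integration_by_substitution_oo (phi dphi G : R -> R) (a b : R) :
  a < b -> derivable_oo_LRcontinuous phi a b ->
  {in `]a, b[, forall x : R, is_derive x (1 : R) phi (dphi x)} ->
  {in `]a, b[, continuous dphi} -> {in `]a, b[, forall x, 0 < dphi x} ->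
  {in `]phi a, phi b[, continuous G} -> {in `]phi a, phi b[, forall x, 0 <= G x} ->
  (\int[mu]_(x in `]phi a, phi b[) (G x)%:E =
   \int[mu]_(x in `]a, b[) (G (phi x) * dphi x)%:E)%E.
Proof.
move=> ab dLR dphiE cdphi dphi0 cG G0.
have phi'E x : x \in `]a, b[%R -> derive1 phi x = dphi x.
  by move=> /dphiE ?; rewrite derive1E; exact: derive_val.
have cphi := derivable_oo_LRcontinuous_within dLR.
have [dphi1 phia phib] := dLR.
have incr : {in `[a, b] &, {homo phi : x y / x < y}}.
  apply: gtr0_derive1_lt_cc => // x xab; rewrite phi'E//; exact: dphi0.
have cphi' : {in `]a, b[, continuous (derive1 phi)}.
  move=> x xab; rewrite /continuous_at phi'E//.
  apply: cvg_trans (cdphi x xab).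
  apply: near_eq_cvg.
  near=> y; rewrite phi'E//; near: y.
  exact: near_in_itvoo.
have cphix : {in `]a, b[, continuous phi}.
  by move=> x xab; apply/differentiable_continuous/derivable1_diffP; exact: dphi1.
(* The denominator is at least 3, so the two margins take at most two thirds of the length and
   [s n < t n] holds already for [n = 0]. *)
pose e n : R := (b - a) / n.+3%:R.
have e0 n : 0 < e n by rewrite divr_gt0// subr_gt0.
have e_cvg : e n @[n --> \oo] --> (0 : R).
  rewrite -[X in _ --> X](mulr0 (b - a)); apply: cvgM; first exact: cvg_cst.
  have := @cvg_harmonic R; rewrite -(cvg_shiftn 2)/=.
  by under eq_fun do rewrite /harmonic/= addn2.
have e_noninc m n : (m <= n)%N -> e n <= e m.
  by move=> mn; rewrite ler_pM2l ?subr_gt0// lef_pV2 ?posrE// ler_nat.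
have e3 n : e n <= (b - a) / 3 by apply: (e_noninc 0).
pose s n := a + e n; pose t n := b - e n.
have as_ n : a < s n by rewrite ltrDl.
have tb n : t n < b by rewrite ltrBlDr ltrDl.
have st n : s n < t n by rewrite /s /t; have := e3 n; lra.
have sab n : s n \in `]a, b[ by rewrite in_itv/= as_ (lt_trans (st n)).
have tab n : t n \in `]a, b[ by rewrite in_itv/= tb (lt_trans _ (st n)).
have s_cvg : s n @[n --> \oo] --> a.
  by rewrite -[X in _ --> X]addr0; apply: cvgD => //; exact: cvg_cst.
have t_cvg : t n @[n --> \oo] --> b.
  by rewrite -[X in _ --> X]subr0; apply: cvgB => //; exact: cvg_cst.
have oocc := @subset_itv_oo_cc _ _ a b.
have aab : a \in `[a, b] by rewrite in_itv/= lexx ltW.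
have bab : b \in `[a, b] by rewrite in_itv/= lexx ltW.
have phias n : phi a < phi (s n) by apply: incr => //; exact: oocc.
have phitb n : phi (t n) < phi b by apply: incr => //; exact: oocc.
have step n : (\int[mu]_(x in `[phi (s n), phi (t n)]) (G x)%:E =
    \int[mu]_(x in `[s n, t n]) (G (phi x) * dphi x)%:E)%E.
  have sub : {subset `]s n, t n[ <= `]a, b[}.
    by move=> x; rewrite !in_itv/= => /andP[sx xt]; rewrite (lt_trans (as_ n))// (lt_trans xt).
  have subcc : {subset `[s n, t n] <= `]a, b[}.
    by move=> x; rewrite !in_itv/= => /andP[sx xt]; rewrite (lt_le_trans (as_ n))// (le_lt_trans xt).
  rewrite (@integration_by_substitution_increasing _ phi G).
  - apply: eq_integral => x; rewrite inE/= => /subcc xab.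
    by rewrite !fctE phi'E.
  - exact: ltW.
  - by move=> x y /subcc/oocc xab /subcc/oocc yab; exact: incr.
  - by move=> x /sub; exact: cphi'.
  - by apply/cvg_ex; exists (derive1 phi (s n)); apply/cvg_at_right_filter/cphi'.
  - by apply/cvg_ex; exists (derive1 phi (t n)); apply/cvg_at_left_filter/cphi'.
  - split.
    + by move=> x /sub; exact: dphi1.
    + exact/cvg_at_right_filter/cphix.
    + exact/cvg_at_left_filter/cphix.
  - apply: continuous_in_subspaceT => x; rewrite inE/= in_itv/= => /andP[sx xt].
    by apply: cG; rewrite in_itv/= (lt_le_trans (phias n))//= (le_lt_trans xt).
have mG : measurable_fun `]phi a, phi b[ (fun x => (G x)%:E).
  by apply/measurable_EFinP; apply: open_continuous_measurable_fun => // x /set_mem; exact: cG.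
have incr_oo x : x \in `]a, b[ -> phi x \in `]phi a, phi b[.
  move=> xab; have := xab; rewrite !in_itv/= => /andP[ax xb].
  by rewrite !incr//; exact: oocc.
have cGphi : {in `]a, b[, continuous (fun x => G (phi x) * dphi x)}.
  move=> x xab; apply: continuousM; last exact: cdphi.
  by apply: continuous_comp; [exact: cphix|apply: cG; exact: incr_oo].
have mGphi : measurable_fun `]a, b[ (fun x => (G (phi x) * dphi x)%:E).
  by apply/measurable_EFinP; apply: open_continuous_measurable_fun => // x /set_mem; exact: cGphi.
have cup1 : \bigcup_n `[s n, t n]%classic = `]a, b[%classic by exact: bigcup_itv_shrink.
(* The one-sided limits of [phi] at [a] and [b] make the image intervals exhaust all of the target
   interval. *)
have cup2 : \bigcup_n `[phi (s n), phi (t n)]%classic = `]phi a, phi b[%classic.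
  apply: bigcup_itv_shrink => //.
  - by move/cvg_at_rightP : phia; apply.
  - by move/cvg_at_leftP : phib; apply.
have nd m n : (m <= n)%N -> s n <= s m /\ t m <= t n.
  by move=> /e_noninc emn; rewrite lerD2l lerB.
have h1 : (\int[mu]_(x in `[s n, t n]) (G (phi x) * dphi x)%:E @[n --> \oo] -->
    \int[mu]_(x in `]a, b[) (G (phi x) * dphi x)%:E)%E.
  rewrite -cup1; apply: ge0_nondecreasing_set_cvg_integral => //.
  - move=> m n /nd[ss tt]; rewrite subsetEset => x /=; rewrite !in_itv/=.
    by move=> /andP[? ?]; apply/andP; split; [exact: le_trans ss _|exact: le_trans tt].
  - by move=> n; apply: measurable_funS mGphi => //; rewrite -cup1 => x ?; exists n.
  - move=> n x xst; have : (\bigcup_n `[s n, t n]%classic) x by exists n.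
    rewrite cup1 /= => xab; rewrite lee_fin mulr_ge0//; first by apply: G0; exact: incr_oo.
    by rewrite ltW// dphi0.
have h2 : (\int[mu]_(x in `[phi (s n), phi (t n)]) (G x)%:E @[n --> \oo] -->
    \int[mu]_(x in `]phi a, phi b[) (G x)%:E)%E.
  have homo : {in `[a, b] &, {homo phi : x y / x <= y}}.
    move=> x y xab yab; rewrite le_eqVlt => /predU1P[->//|xy].
    by apply/ltW/incr.
  rewrite -cup2; apply: ge0_nondecreasing_set_cvg_integral => //.
  - move=> m n /nd[ss tt]; rewrite subsetEset => x /=; rewrite !in_itv/=.
    move=> /andP[? ?]; apply/andP; split.
      by apply: le_trans (homo _ _ _ _ ss) _ => //; exact: oocc.
    by apply: le_trans (homo _ _ _ _ tt) => //; exact: oocc.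
  - by move=> n; apply: measurable_funS mG => //; rewrite -cup2 => x ?; exists n.
  - move=> n x xst; have : (\bigcup_n `[phi (s n), phi (t n)]%classic) x by exists n.
    by rewrite cup2 /= => xab; rewrite lee_fin G0.
move: h2; rewrite (eq_cvg _ _ step) => h2.
exact: (cvg_unique _ h2 h1).
Unshelve. all: by end_near. Qed.

End substitution_on_open_intervals.

(** * Convolution rule, Gamma-Beta relation and recurrence, in the extended reals *)

Section gamma_beta_identities.
Context {R : realType}.
Implicit Types (lam a b x u z : R).
Local Notation mu := (@lebesgue_measure R).

(** In the coordinates [(z, u)] the indicator of [A] depends on [z] alone, so the integral over [u]
    splits off as a constant. *)
Lemma gamma_ker_convolution lam a b (A : set R) : measurable A ->
  (\int[mu]_x \int[mu]_y
     ((gamma_ker lam a x * gamma_ker lam b y)%:E * (\1_A (x + y)%R)%:E) =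
   beta_mass a b * \int[mu]_(z in A) (gamma_ker lam (a + b) z)%:E)%E.
Proof.
move=> mA.
have mH : measurable_fun [set: R * R] (fun p : R * R => (\1_A (p.1 + p.2) : R)%:E).
  apply/measurable_EFinP/measurableT_comp => //.
  exact: measurable_funD.
rewrite (gamma_ker_polar _ _ _ (fun p => (\1_A (p.1 + p.2))%:E))//.
under eq_integral => z _.
  under eq_integral => u _.
    rewrite /= -mulrDr subrKC mulr1 muleC; over.
  rewrite ge0_integralZl//; last 2 first.
    by apply/measurable_EFinP; exact: measurable_beta_ker.
    by move=> u _; rewrite lee_fin beta_ker_ge0.
  rewrite -/(beta_mass a b) muleC -muleA muleCA; over.
rewrite ge0_integralZl//; last 3 first.
  apply: emeasurable_funM; first exact/measurable_EFinP.
  by apply/measurable_EFinP; exact: measurable_gamma_ker.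
  by move=> z _; rewrite mule_ge0// lee_fin// gamma_ker_ge0.
  exact: beta_mass_ge0.
congr (_ * _)%E; rewrite [RHS]integral_mkcond; apply: eq_integral => z _.
by rewrite /patch indicE; case: ifP => _; rewrite ?mul1e ?mul0e.
Qed.

Lemma gamma_massM lam a b :
  (gamma_mass lam a * gamma_mass lam b = beta_mass a b * gamma_mass lam (a + b))%E.
Proof.
have := @gamma_ker_convolution lam a b setT measurableT.
rewrite -/(gamma_mass _ _) => <-.
under [RHS]eq_integral => x _.
  under eq_integral => y _ do rewrite indicT mule1 EFinM.
  rewrite ge0_integralZl//; last 3 first.
    by apply/measurable_EFinP; exact: measurable_gamma_ker.
    by move=> y _; rewrite lee_fin gamma_ker_ge0.
    by rewrite lee_fin gamma_ker_ge0.
  rewrite -/(gamma_mass lam b) muleC; over.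
rewrite ge0_integralZl//; last 3 first.
  by apply/measurable_EFinP; exact: measurable_gamma_ker.
  by move=> y _; rewrite lee_fin gamma_ker_ge0.
  exact: gamma_mass_ge0.
by rewrite muleC.
Qed.

Lemma gamma_mass_scale lam a : 0 < lam ->
  gamma_mass lam a = ((lam `^ a)%:E * gamma_mass 1 a)%E.
Proof.
move=> lam0; rewrite /gamma_mass -(ge0_integral_dilate _ _ lam0); first last.
- by move=> x; rewrite lee_fin gamma_ker_ge0.
- by apply/measurable_EFinP; exact: measurable_gamma_ker.
rewrite -!ge0_integralZl//; first last.
- by rewrite lee_fin ltW.
- by move=> x _; rewrite lee_fin gamma_ker_ge0.
- apply/measurable_EFinP; apply: measurableT_comp (measurable_gamma_ker _ _) _.
  exact: measurable_funM.
- by rewrite lee_fin powR_ge0.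
- by move=> x _; rewrite lee_fin gamma_ker_ge0.
- by apply/measurable_EFinP; exact: measurable_gamma_ker.
apply: eq_integral => x _; rewrite -!EFinM; congr EFin.
rewrite /gamma_ker pmulr_rgt0//; case: ltP => x0; last by rewrite !mulr0.
rewrite powRM ?ltW// !mulrA -{1}(powRr1 (ltW lam0)) -powRD ?(gt_eqF lam0) ?implybT//.
rewrite subrKC; congr (_ * expR _); field; exact: lt0r_neq0.
Qed.

Lemma gamma_mass_oy lam a :
  (\int[mu]_(x in `]0%R, +oo[) (x `^ (a - 1) * expR (- x / lam))%:E = gamma_mass lam a)%E.
Proof.
rewrite /gamma_mass integral_mkcond; apply: eq_integral => x _.
by rewrite /patch /gamma_ker mem_setE in_itv/= andbT; case: ifP.
Qed.

Lemma gamma_mass_cy lam a :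
  (\int[mu]_(x in `[0%R, +oo[) (x `^ (a - 1) * expR (- x / lam))%:E = gamma_mass lam a)%E.
Proof.
rewrite -integral_itv_obnd_cbnd ?gamma_mass_oy//.
apply/measurable_EFinP/measurable_funM => //.
  by apply: measurable_funTS; exact: measurable_powR.
apply: measurable_funTS; apply: measurableT_comp => //.
exact: measurable_funM.
Qed.

Lemma GammaE a : Gamma a = fine (gamma_mass 1 a).
Proof.
rewrite -gamma_mass_oy /Gamma; congr fine.
by apply: eq_integral => x _; rewrite divr1.
Qed.

Lemma gamma_mass1 lam : 0 < lam -> gamma_mass lam 1 = lam%:E.
Proof.
move=> lam0; rewrite -gamma_mass_cy.
have lamV : 0 < lam^-1 by rewrite invr_gt0.
have := integral_exponential_pdf lamV.
rewrite /exponential_pdf => h.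
transitivity (lam%:E * 1)%E; last by rewrite mule1.
rewrite -h integral_mkcond -ge0_integralZl//; first last.
- by rewrite lee_fin ltW.
- by move=> x _; rewrite lee_fin exponential_pdf_ge0// ltW.
- apply/measurable_EFinP; apply: measurable_exponential_pdf; exact: ltW.
apply: eq_integral => x _; rewrite !patchE; case: ifP => _; last by rewrite mule0.
rewrite -EFinM subrr powRr0 mul1r mulrA divff ?mul1r ?gt_eqF//.
by congr (expR _)%:E; ring.
Qed.

Lemma beta_mass_sym a b : beta_mass a b = beta_mass b a.
Proof.
rewrite /beta_mass -(ge0_integral_reflect 1); first last.
- by move=> x; rewrite lee_fin beta_ker_ge0.
- by apply/measurable_EFinP; exact: measurable_beta_ker.
apply: eq_integral => u _; rewrite /beta_ker; congr EFin.
by rewrite subr_gt0 ltrBlDr ltrDl andbC subKr mulrC.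
Qed.

Lemma beta_mass_itv a b :
  beta_mass a b = (\int[mu]_(u in `]0%R, 1%R[) (u `^ (a - 1) * (1 - u) `^ (b - 1))%:E)%E.
Proof.
rewrite [RHS]integral_mkcond; apply: eq_integral => u _.
by rewrite patchE mem_setE in_itv/= /beta_ker; case: ifP.
Qed.

Lemma continuous_powRl (p x : R) : 0 < x -> {for x, continuous (fun y : R => y `^ p)}.
Proof.
move=> x0; apply/differentiable_continuous/derivable1_diffP.
by apply: derivable_powR; rewrite in_itv/= x0.
Qed.

(** The substitution [t = u ^ a] turns [a * u ^ (a - 1)] into the constant 1, which also covers
    [a < 1], where the integrand is unbounded at 0. *)
Lemma beta_mass1 a : 0 < a -> beta_mass a 1 = (a^-1)%:E.
Proof.
move=> a0; rewrite beta_mass_itv.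
transitivity (\int[mu]_(u in `]0%R, 1%R[) ((a^-1) * (a * u `^ (a - 1)))%:E)%E.
  apply: eq_integral => u _; rewrite subrr powRr0 mulr1 mulrA mulVf ?mul1r//.
  exact: lt0r_neq0.
have pow0 : (0 : R) `^ a = 0 by rewrite powR0// gt_eqF.
rewrite -(@ge0_integration_by_substitution_oo R (fun u => u `^ a)
  (fun u => a * u `^ (a - 1)) (fun=> a^-1))//.
- rewrite pow0 powR1 integral_cst//= lebesgue_measure_itv/= lte_fin ltr01.
  by rewrite sube0 mule1.
- split.
  + move=> x; rewrite in_itv/= => /andP[x0 _].
    by apply: derivable_powR; rewrite in_itv/= x0.
  + by rewrite pow0; exact: powR_cvg0.
  + exact/cvg_at_left_filter/continuous_powRl.
- by move=> x; rewrite in_itv/= => /andP[x0 _]; exact: is_derive1_powR.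
- move=> x; rewrite in_itv/= => /andP[x0 _]; apply: cvgM; first exact: cvg_cst.
  exact: continuous_powRl.
- by move=> x; rewrite in_itv/= => /andP[x0 _]; rewrite mulr_gt0// powR_gt0.
- by move=> x _; exact: cvg_cst.
- by move=> x _; rewrite invr_ge0 ltW.
Qed.

(** This is the Gamma-Beta relation at [b = 1], where the masses [gamma_mass lam 1 = lam] and
    [beta_mass a 1 = 1 / a] are explicit. *)
Lemma gamma_massS lam a : 0 < lam -> 0 < a ->
  gamma_mass lam (a + 1) = ((a * lam)%:E * gamma_mass lam a)%E.
Proof.
move=> lam0 a0; have := gamma_massM lam a 1.
rewrite gamma_mass1// beta_mass1// EFinM -muleA (muleC lam%:E) => ->.
by rewrite muleA -EFinM divff ?mul1e// gt_eqF.
Qed.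

End gamma_beta_identities.

(** * Symmetric beta integrals and homogeneous weights *)

Section beta_integrals.
Context {R : realType}.
Implicit Types (lam a b x u z : R).
Local Notation mu := (@lebesgue_measure R).

Lemma ge0_integral_symmetric (c : R) (f : R -> \bar R) :
  measurable_fun [set: R] f -> (forall x, 0 <= f x)%E ->
  (forall x, f (c - x) = f x) ->
  (\int[mu]_x f x = 2%:E * \int[mu]_(x in `](c / 2)%R, +oo[) f x)%E.
Proof.
move=> mf f0 fc.
have mfr : measurable_fun [set: R] (f \_ `]-oo, (c / 2)%R]).
  by apply/(measurable_restrictT f) => //; exact: measurable_funTS.
rewrite -(setUv `](c / 2)%R, +oo[%classic) ge0_integral_setU//; last 3 first.
- exact: measurableC.
- by rewrite setUv.
- by apply/disj_setPRL.
rewrite setCitvr mule_natl mule2n; congr (_ + _)%E.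
(* The reflection about [c / 2] sends the left half to the closed right half; the midpoint has
   measure zero. *)
transitivity (\int[mu]_(x in `[(c / 2)%R, +oo[) f x)%E.
  rewrite integral_mkcond -(ge0_integral_reflect c)//; last first.
    by move=> x; apply: erestrict_ge0.
  rewrite [RHS]integral_mkcond; apply: eq_integral => x _; rewrite !patchE fc.
  rewrite !mem_setE !in_itv/= andbT.
  suff -> : (c - x <= c / 2) = (c / 2 <= x) by [].
  by apply/idP/idP; lra.
by rewrite -integral_itv_obnd_cbnd//; exact: measurable_funTS.
Qed.

(* Since [1 - (2 * u - 1) ^+ 2 = 4 * (u * (1 - u))], this substitution relates the
   symmetric kernel [beta_ker a a] on its right half both to [beta_ker (1 / 2) a]
   and, after weighting by [2 * u - 1], to [beta_ker 1 a]. *)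
Lemma integral_fold (G : R -> R) :
  {in `]0, 1[, continuous G} -> {in `]0, 1[, forall x, 0 <= G x} ->
  (\int[mu]_(x in `]0%R, 1%R[) (G x)%:E =
   \int[mu]_(u in `](1 / 2)%R, 1%R[) (G ((2 * u - 1) ^+ 2) * (4 * (2 * u - 1)))%:E)%E.
Proof.
move=> cG G0.
pose phi u : R := (2 * u - 1) ^+ 2.
have phi0 : phi (1 / 2) = 0 by rewrite /phi; field.
have phi1 : phi 1 = 1 by rewrite /phi; ring.
have dphi (x : R) : is_derive x (1 : R) phi (4 * (2 * x - 1)).
  by apply: is_derive_eq; rewrite /GRing.scale/=; ring.
have cphi x : {for x, continuous phi}.
  apply/differentiable_continuous/derivable1_diffP.
  exact: ex_derive.
have clin : continuous (fun u : R => 4 * (2 * u - 1)).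
  move=> x; apply: cvgM; first exact: cvg_cst.
  apply: cvgB; last exact: cvg_cst.
  by apply: cvgM; first exact: cvg_cst.
have := @ge0_integration_by_substitution_oo R phi (fun u => 4 * (2 * u - 1)) G (1 / 2) 1.
rewrite phi0 phi1; apply => //.
- by lra.
- split; [by move=> x _; exact: ex_derive|exact/cvg_at_right_filter/cphi|].
  exact/cvg_at_left_filter/cphi.
- by move=> x; rewrite in_itv/= => /andP[? ?]; lra.
Qed.

(** Only the right half is kept because [(2 * u - 1) ^+ 2] is increasing there and [2 * u - 1]
    equals its absolute value. *)
Lemma beta_ker_halves a (w : R -> R) :
  measurable_fun [set: R] w -> (forall u, 0 <= w u) -> (forall u, w (1 - u) = w u) ->
  (\int[mu]_u (beta_ker a a u * w u)%:E =
   2%:E * \int[mu]_(u in `](1 / 2)%R, 1%R[) ((u * (1 - u)) `^ (a - 1) * w u)%:E)%E.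
Proof.
move=> mw w0 wsym.
rewrite (@ge0_integral_symmetric 1); first last.
- move=> u; rewrite wsym /beta_ker; congr (_ * _)%:E.
  by rewrite subr_gt0 ltrBlDr ltrDl andbC subKr mulrC.
- by move=> u; rewrite lee_fin mulr_ge0// beta_ker_ge0.
- by apply/measurable_EFinP/measurable_funM => //; exact: measurable_beta_ker.
congr (_ * _)%E; rewrite integral_mkcond [RHS]integral_mkcond.
apply: eq_integral => u _; rewrite !patchE !mem_setE !in_itv/= andbT /beta_ker.
case: ltP => //= u2; have u0 : 0 < u by lra.
rewrite u0/=; case: ltP => u1; last by rewrite mul0r.
by rewrite powRM ?(ltW u0)// subr_ge0 ltW.
Qed.

Lemma fold_complement (u : R) : 1 - (2 * u - 1) ^+ 2 = 4 * (u * (1 - u)).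
Proof. by ring. Qed.

Let continuous_powR_onem (p x : R) : x < 1 -> {for x, continuous (fun y : R => (1 - y) `^ p)}.
Proof.
move=> x1; apply: (@continuous_comp _ _ _ (fun y : R => 1 - y) (fun y => y `^ p)).
  by apply: cvgB; first exact: cvg_cst.
by apply: continuous_powRl; rewrite subr_gt0.
Qed.

Let powR4_pred a : (4 : R) `^ a = 4 * 4 `^ (a - 1).
Proof.
by rewrite -[X in X * _](@powRr1 _ 4)// -powRD ?subrKC// pnatr_eq0 implybT.
Qed.

(** Legendre's duplication formula in Beta form. The factor [t ^ (- 1 / 2)] becomes the inverse of
    [2 * u - 1] and cancels that part of the Jacobian; the remaining 4 joins [4 ^ (a - 1)]. *)
Lemma beta_mass_duplication a :
  ((4 `^ a)%:E * beta_mass a a = 2%:E * beta_mass (1 / 2) a)%E.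
Proof.
have -> : beta_mass a a = (\int[mu]_u (beta_ker a a u * cst 1 u)%:E)%E.
  by apply: eq_integral => u _; rewrite mulr1.
rewrite beta_ker_halves// muleCA; congr (_ * _)%E.
rewrite beta_mass_itv.
rewrite (integral_fold (fun x => x `^ (1 / 2 - 1) * (1 - x) `^ (a - 1))); last 2 first.
- move=> x; rewrite in_itv/= => /andP[x0 x1].
  by apply: cvgM; [exact: continuous_powRl|exact: continuous_powR_onem].
- by move=> x _; rewrite mulr_ge0 ?powR_ge0.
rewrite -ge0_integralZl//; last 2 first.
- apply/measurable_EFinP/measurable_funM => //; apply: measurable_funTS.
  apply: measurableT_comp (measurable_powR _) _ => //; apply: measurable_funM => //.
  exact: measurable_funB.
- by move=> u _; rewrite lee_fin mulr_ge0 ?powR_ge0.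
apply: eq_integral => u; rewrite inE/= in_itv/= => /andP[u12 u1].
rewrite -EFinM; congr EFin; rewrite mulr1 fold_complement.
have w0 : 0 < 2 * u - 1 by lra.
have p0 : 0 < u * (1 - u) by apply: mulr_gt0; lra.
rewrite [(4 * (u * (1 - u))) `^ _]powRM ?(ltW p0)//.
have -> : ((2 * u - 1) ^+ 2) `^ (1 / 2 - 1) = (2 * u - 1)^-1.
  rewrite -powR_mulrn ?ltW// -powRrM -(powR_inv1 (ltW w0)).
  by congr (_ `^ _); field.
rewrite (powR4_pred a).
by field; exact: lt0r_neq0.
Qed.

(** Here the weight is itself the Jacobian up to a factor 4, so the fold leads to the integral of
    [(1 - t) ^ (a - 1)], which is [1 / a]. *)
Lemma beta_abs_difference a : 0 < a ->
  (\int[mu]_u (beta_ker a a u * `|2 * u - 1|)%:E = (2 / (a * 4 `^ a))%:E)%E.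
Proof.
move=> a0; rewrite beta_ker_halves; first last.
- by move=> u; rewrite -normrN; congr `|_|; ring.
- by [].
- by apply: measurableT_comp => //; apply: measurable_funB.
rewrite EFinM; congr (_ * _)%E; rewrite invfM EFinM.
have -> : ((a^-1)%:E = \int[mu]_(u in `]0%R, 1%R[) ((1 - u) `^ (a - 1))%:E)%E.
  rewrite -beta_mass1// beta_mass_sym beta_mass_itv.
  by apply: eq_integral => u _; rewrite subrr powRr0 mul1r.
rewrite (integral_fold (fun x => (1 - x) `^ (a - 1))); last 2 first.
- by move=> x; rewrite in_itv/= => /andP[x0 x1]; exact: continuous_powR_onem.
- by move=> x _; rewrite powR_ge0.
rewrite muleC -ge0_integralZl//; last 2 first.
- have mlin : measurable_fun [set: R] (fun u => 2 * u - 1) by exact: measurable_funB.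
  apply/measurable_EFinP/measurable_funTS/measurable_funM; last exact: measurable_funM.
  apply: measurableT_comp (measurable_powR _) _; apply: measurable_funB => //.
  exact: measurable_funX.
- by move=> u /=; rewrite in_itv/= => /andP[u12 _]; rewrite lee_fin mulr_ge0 ?powR_ge0//; lra.
apply: eq_integral => u; rewrite inE/= in_itv/= => /andP[u12 u1].
rewrite -EFinM; congr EFin; rewrite fold_complement.
have w0 : 0 < 2 * u - 1 by lra.
have p0 : 0 < u * (1 - u) by apply: mulr_gt0; lra.
rewrite (gtr0_norm w0) [(4 * (u * (1 - u))) `^ _]powRM ?(ltW p0)//.
rewrite (powR4_pred a).
by field; rewrite gt_eqF ?powR_gt0.
Qed.

(** A weight homogeneous of degree [k] contributes [z ^ k], which the gamma factor absorbs by
    raising its shape by [k]. *)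
Lemma gamma_ker_homogeneous lam a b (k : nat) (w : R * R -> R) :
  measurable_fun [set: R * R] w -> (forall p, 0 <= w p) ->
  (forall z p, 0 < z -> w (z * p.1, z * p.2) = z ^+ k * w p) ->
  (\int[mu]_x \int[mu]_y ((gamma_ker lam a x * gamma_ker lam b y)%:E * (w (x, y))%:E) =
   (\int[mu]_u (beta_ker a b u * w (u, (1 - u)%R))%:E) * gamma_mass lam (a + b + k%:R))%E.
Proof.
move=> mw w0 wk.
have mwu : measurable_fun [set: R] (fun u => w (u, 1 - u)).
  by apply: measurableT_comp mw _; apply: measurable_fun_pair => //; exact: measurable_funB.
rewrite (gamma_ker_polar _ _ _ (fun p => (w p)%:E))//; last exact/measurable_EFinP.
rewrite [in RHS]/gamma_mass -ge0_integralZl; first last.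
- by apply: integral_ge0 => u _; rewrite lee_fin mulr_ge0// beta_ker_ge0.
- by move=> x _; rewrite lee_fin gamma_ker_ge0.
- by apply/measurable_EFinP; exact: measurable_gamma_ker.
- by [].
apply: eq_integral => z _ /=.
have [z0|z0] := ltP 0 z; last by rewrite /gamma_ker ltNge z0/= mul0e mule0.
under eq_integral => u _.
  rewrite (wk z (u, 1 - u))// -EFinM mulrCA EFinM; over.
rewrite ge0_integralZl; first last.
- by rewrite lee_fin exprn_ge0// ltW.
- by move=> u _; rewrite lee_fin mulr_ge0// beta_ker_ge0.
- by apply/measurable_EFinP/measurable_funM => //; exact: measurable_beta_ker.
- by [].
rewrite muleA -EFinM muleC; congr (_ * _%:E)%E.
rewrite /gamma_ker z0 mulrAC -(powR_mulrn _ (ltW z0)) -powRD ?(gt_eqF z0) ?implybT//.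
by congr (_ `^ _ * _); ring.
Qed.

End beta_integrals.

(** * Finiteness and positivity of Gamma, and the resulting real identities *)

Section gamma_function.
Context {R : realType}.
Implicit Types (lam a b x u z : R).
Local Notation mu := (@lebesgue_measure R).

(** Serves the strict positivity of Gamma. On []0, 1[] the exponential is at least [expR (-1)], so
    the kernel dominates a multiple of [beta_ker a 1]. *)
Lemma gamma_mass_lower a : 0 < a -> ((expR (-1) / a)%:E <= gamma_mass 1 a)%E.
Proof.
move=> a0; rewrite EFinM -beta_mass1// -ge0_integralZl//; last 2 first.
- by apply/measurable_EFinP; exact: measurable_beta_ker.
- by move=> x _; rewrite lee_fin beta_ker_ge0.
apply: ge0_le_integral => //.
- by move=> x _; rewrite mule_ge0// lee_fin ?expR_ge0// beta_ker_ge0.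
- apply: emeasurable_funM => //; apply/measurable_EFinP; exact: measurable_beta_ker.
- by apply/measurable_EFinP; exact: measurable_gamma_ker.
move=> x _; rewrite -EFinM lee_fin; case: (boolP ((0 < x) && (x < 1))) => [x01|x01].
  rewrite /beta_ker x01 /gamma_ker; move: x01 => /andP[x0 x1]; rewrite x0.
  rewrite subrr powRr0 mulr1 mulrC ler_wpM2l ?powR_ge0// ler_expR divr1; lra.
by rewrite /beta_ker (negbTE x01) mulr0 gamma_ker_ge0.
Qed.

(** Below 1 the exponential is at most 1, and from 1 on the power is at most 1 because [a <= 1]; the
    kernel is thus dominated by [beta_ker a 1] plus [gamma_ker 1 1]. *)
Lemma gamma_mass_upper a : 0 < a -> a <= 1 -> (gamma_mass 1 a <= (a^-1 + 1)%:E)%E.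
Proof.
move=> a0 a1; rewrite EFinD -beta_mass1// -gamma_mass1// -ge0_integralD//; first last.
- by apply/measurable_EFinP; exact: measurable_gamma_ker.
- by move=> x _; rewrite lee_fin gamma_ker_ge0.
- by apply/measurable_EFinP; exact: measurable_beta_ker.
- by move=> x _; rewrite lee_fin beta_ker_ge0.
apply: ge0_le_integral => //.
- by move=> x _; rewrite lee_fin gamma_ker_ge0.
- by apply/measurable_EFinP; exact: measurable_gamma_ker.
- apply: emeasurable_funD; apply/measurable_EFinP.
    exact: measurable_beta_ker.
  exact: measurable_gamma_ker.
move=> x _; rewrite -EFinD lee_fin /gamma_ker /beta_ker !subrr.
case: ltP => x0 /=; last by rewrite addr0.
rewrite !powRr0 mulr1 mul1r; case: ltP => x1.
  rewrite -[leLHS]addr0 lerD ?expR_ge0// ler_piMr ?powR_ge0//.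
  by rewrite divr1 -expR0 ler_expR; lra.
rewrite add0r ler_piMl ?expR_ge0// -[leRHS](powRr0 x) ler_powR//; lra.
Qed.

Lemma gamma_mass_fin_num a : 0 < a -> gamma_mass 1 a \is a fin_num.
Proof.
have ind n b : 0 < b -> b <= n%:R -> gamma_mass 1 b \is a fin_num.
  elim: n b => [|n ih] b b0 bn; first by have := lt_le_trans b0 bn; rewrite ltxx.
  have [b1|b1] := leP b 1.
    rewrite ge0_fin_numE ?gamma_mass_ge0//.
    exact: le_lt_trans (gamma_mass_upper _ b0 b1) (ltry _).
  rewrite -(subrK 1 b) gamma_massS ?subr_gt0// fin_numM//.
  by apply: ih; rewrite ?subr_gt0// lerBlDr natr1.
move=> a0; apply: (ind (Num.bound a)) => //.
by rewrite ltW// archi_boundP// ltW.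
Qed.

Lemma Gamma_gt0 a : 0 < a -> 0 < Gamma a.
Proof.
move=> a0; rewrite GammaE -lte_fin fineK ?gamma_mass_fin_num//.
by apply: lt_le_trans (gamma_mass_lower _ a0); rewrite lte_fin divr_gt0// expR_gt0.
Qed.

Lemma gamma_massE lam a : 0 < lam -> 0 < a ->
  gamma_mass lam a = (lam `^ a * Gamma a)%:E.
Proof.
by move=> lam0 a0; rewrite gamma_mass_scale// GammaE EFinM fineK ?gamma_mass_fin_num.
Qed.

Lemma GammaS a : 0 < a -> Gamma (a + 1) = a * Gamma a.
Proof.
move=> a0; have a10 : 0 < a + 1 by rewrite addr_gt0.
have := gamma_massS 1 a ltr01 a0.
rewrite (gamma_massE _ _ ltr01 a0) (gamma_massE _ _ ltr01 a10).
by rewrite !powR1 !mul1r mulr1 -EFinM => -[].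
Qed.

Lemma BetaE a b : Beta a b = Gamma a * Gamma b / Gamma (a + b).
Proof. by []. Qed.

Lemma Beta_gt0 a b : 0 < a -> 0 < b -> 0 < Beta a b.
Proof. by move=> a0 b0; rewrite BetaE divr_gt0 ?mulr_gt0 ?Gamma_gt0 ?addr_gt0. Qed.

Lemma beta_massE a b : 0 < a -> 0 < b -> beta_mass a b = (Beta a b)%:E.
Proof.
move=> a0 b0; have ab0 : 0 < a + b by rewrite addr_gt0.
have h := gamma_massM 1 a b; rewrite BetaE.
rewrite (gamma_massE _ _ ltr01 a0) (gamma_massE _ _ ltr01 b0) in h.
rewrite (gamma_massE _ _ ltr01 ab0) !powR1 !mul1r in h.
have := Gamma_gt0 _ ab0; move: (Gamma (a + b)) (Gamma a) (Gamma b) h => g ga gb h g0.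
(* An infinite beta mass times the positive [Gamma (a + b)] would be infinite, whereas the product
   of two Gamma values is finite. *)
have bfin : beta_mass a b \is a fin_num.
  rewrite ge0_fin_numE ?beta_mass_ge0// ltNge leye_eq; apply/negP => /eqP bE.
  by move: h; rewrite bE gt0_mulye.
by move: h; rewrite -(fineK bfin) -!EFinM => -[->]; rewrite mulfK// gt_eqF.
Qed.

Lemma Beta_duplication a : 0 < a -> 4 `^ a * Beta a a = 2 * Beta (1 / 2) a.
Proof.
move=> a0; have h0 : 0 < 1 / 2 :> R by rewrite divr_gt0.
have := beta_mass_duplication a.
rewrite (beta_massE a a a0 a0) (beta_massE (1 / 2) a h0 a0).
by move: (Beta a a) (Beta (1 / 2) a) => B1 B2; rewrite -!EFinM => -[].
Qed.

(** Write [(2 u - 1) ^ 2] as [1 - 4 u (1 - u)]; the factor [u (1 - u)] raises both parameters by 1.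
    The proof adds instead of subtracting, to remain among nonnegative integrals. *)
Lemma beta_sqr_difference a : 0 < a ->
  (\int[mu]_u (beta_ker a a u * (2 * u - 1) ^+ 2)%:E =
   (Beta a a - 4 * Beta (a + 1) (a + 1))%:E)%E.
Proof.
move=> a0; have a10 : 0 < a + 1 by rewrite addr_gt0.
have mw : measurable_fun [set: R] (fun u => beta_ker a a u * (2 * u - 1) ^+ 2).
  apply: measurable_funM; first exact: measurable_beta_ker.
  by apply: measurable_funX; exact: measurable_funB.
have split : beta_mass a a = ((\int[mu]_u (beta_ker a a u * (2 * u - 1) ^+ 2)%:E) +
    4%:E * beta_mass (a + 1) (a + 1))%E.
  rewrite -ge0_integralZl//; last 2 first.
  - by apply/measurable_EFinP; exact: measurable_beta_ker.
  - by move=> u _; rewrite lee_fin beta_ker_ge0.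
  rewrite -ge0_integralD//; first last.
  - by apply: emeasurable_funM => //; apply/measurable_EFinP; exact: measurable_beta_ker.
  - by move=> u _; rewrite mule_ge0// lee_fin beta_ker_ge0.
  - exact/measurable_EFinP.
  - by move=> u _; rewrite lee_fin mulr_ge0 ?beta_ker_ge0// sqr_ge0.
  apply: eq_integral => u _; rewrite -EFinM -EFinD; congr EFin; rewrite /beta_ker.
  case: ifPn => [/andP[u0 u1]|_]; last by rewrite mul0r mulr0 addr0.
  have v0 : 0 < 1 - u by rewrite subr_gt0.
  rewrite !addrK -(mulr_powRB1 (ltW u0) a0) -(mulr_powRB1 (ltW v0) a0); ring.
move: split; rewrite (beta_massE a a a0 a0) (beta_massE _ _ a10 a10).
move: (Beta _ _) (Beta _ _) => B1 B2.
by rewrite EFinB EFinM => ->; rewrite addeK.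
Qed.

End gamma_function.

(** * Normalized gamma densities: additivity and moments of the difference *)

Section gamma_density.
Context {R : realType}.
Implicit Types (lam a b x u z : R).
Local Notation mu := (@lebesgue_measure R).

Definition gamma_dens lam a x : R := gamma_ker lam a x / (lam `^ a * Gamma a).

Let norm_gt0 lam a : 0 < lam -> 0 < a -> 0 < lam `^ a * Gamma a.
Proof. by move=> lam0 a0; apply: mulr_gt0; [exact: powR_gt0|exact: Gamma_gt0]. Qed.

Lemma gamma_dens_ge0 lam a x : 0 < lam -> 0 < a -> 0 <= gamma_dens lam a x.
Proof.
move=> lam0 a0; have := norm_gt0 _ _ lam0 a0; rewrite /gamma_dens.
by move: (_ * _) => C C0; rewrite divr_ge0 ?gamma_ker_ge0// ltW.
Qed.

Lemma measurable_gamma_dens lam a : measurable_fun [set: R] (gamma_dens lam a).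
Proof. by apply: measurable_funM; [exact: measurable_gamma_ker|exact: measurable_cst]. Qed.

Lemma integral_gamma_kerZ lam a b (c e : R) (f : R * R -> \bar R) :
  0 <= c -> 0 <= e ->
  measurable_fun [set: R * R] f -> (forall p, 0 <= f p)%E ->
  (\int[mu]_x \int[mu]_y (((gamma_ker lam a x * c) * (gamma_ker lam b y * e))%:E * f (x, y)) =
   (c * e)%:E *
   \int[mu]_x \int[mu]_y ((gamma_ker lam a x * gamma_ker lam b y)%:E * f (x, y)))%E.
Proof.
move=> c0 e0 mf f0.
have mk : measurable_fun [set: R * R] (fun p =>
    (gamma_ker lam a p.1 * gamma_ker lam b p.2)%:E * f p)%E.
  apply: emeasurable_funM => //; apply/measurable_EFinP/measurable_funM.
    exact: measurableT_comp (measurable_gamma_ker _ _) _.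
  exact: measurableT_comp (measurable_gamma_ker _ _) _.
have k0 p : (0 <= (gamma_ker lam a p.1 * gamma_ker lam b p.2)%:E * f p)%E.
  by rewrite mule_ge0// lee_fin mulr_ge0// gamma_ker_ge0.
have ce0 : (0 <= (c * e)%:E)%E by rewrite lee_fin mulr_ge0.
rewrite -ge0_integralZl; first last.
- exact: ce0.
- by move=> x _; apply: integral_ge0 => y _; exact: (k0 (x, y)).
- exact: (measurable_fun_fubini_tonelli_F (m2 := mu) _ mk k0).
- by [].
apply: eq_integral => x _; rewrite -ge0_integralZl; first last.
- exact: ce0.
- by move=> y _; exact: (k0 (x, y)).
- exact: measurable_fun_pair2 mk.
- by [].
apply: eq_integral => y _; rewrite muleA -EFinM; congr (_%:E * _)%E.
by rewrite mulrACA mulrC.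
Qed.

Lemma gamma_dens_convolution lam a b (A : set R) : 0 < lam -> 0 < a -> 0 < b ->
  measurable A ->
  (\int[mu]_x \int[mu]_y
     ((gamma_dens lam a x * gamma_dens lam b y)%:E * (\1_A (x + y)%R)%:E) =
   \int[mu]_(z in A) (gamma_dens lam (a + b) z)%:E)%E.
Proof.
move=> lam0 a0 b0 mA; have ab0 : 0 < a + b by rewrite addr_gt0.
rewrite /gamma_dens.
have Ca0 := norm_gt0 _ _ lam0 a0; have Cb0 := norm_gt0 _ _ lam0 b0.
have Cab0 := norm_gt0 _ _ lam0 ab0.
(* The two normalizing constants and the Beta factor left by the convolution combine to the
   normalizing constant of shape [a + b]. *)
have CE : (lam `^ a * Gamma a)^-1 * (lam `^ b * Gamma b)^-1 * Beta a b =
    (lam `^ (a + b) * Gamma (a + b))^-1.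
  rewrite BetaE powRD ?(gt_eqF lam0) ?implybT//.
  move: (powR_gt0 a lam0) (powR_gt0 b lam0) (Gamma_gt0 _ a0) (Gamma_gt0 _ b0) (Gamma_gt0 _ ab0).
  move: (lam `^ a) (lam `^ b) (Gamma (a + b)) (Gamma a) (Gamma b).
  by move=> la lb gab ga gb *; field; rewrite !gt_eqF.
move: (lam `^ a * _) (lam `^ b * _) (lam `^ (a + b) * _) Ca0 Cb0 Cab0 CE => Ca Cb Cab Ca0 Cb0 Cab0.
move=> CE; rewrite (integral_gamma_kerZ _ _ _ _ _ (fun p => (\1_A (p.1 + p.2)%R)%:E)); first last.
- by move=> p; rewrite lee_fin.
- by apply/measurable_EFinP/measurableT_comp => //; exact: measurable_funD.
- by rewrite invr_ge0 ltW.
- by rewrite invr_ge0 ltW.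
rewrite gamma_ker_convolution// (beta_massE _ _ a0 b0) muleA -EFinM CE.
rewrite -ge0_integralZl; first last.
- by rewrite lee_fin invr_ge0 ltW.
- by move=> x _; rewrite lee_fin gamma_ker_ge0.
- by apply/measurable_EFinP/measurable_funTS; exact: measurable_gamma_ker.
- by [].
by apply: eq_integral => z _; rewrite -EFinM mulrC.
Qed.

Lemma gamma_dens_abs_difference lam a : 0 < lam -> 0 < a ->
  (\int[mu]_x \int[mu]_y
     ((gamma_dens lam a x * gamma_dens lam a y)%:E * `|x - y|%:E) =
   (2 / Beta (1 / 2) a * lam)%:E)%E.
Proof.
move=> lam0 a0; have aa0 : 0 < a + a by rewrite addr_gt0.
have aa10 : 0 < a + a + 1 by rewrite addr_gt0.
have mw : measurable_fun [set: R * R] (fun p : R * R => `|p.1 - p.2|).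
  by apply: measurableT_comp => //; exact: measurable_funB.
have C0 : 0 <= (lam `^ a * Gamma a)^-1 by rewrite invr_ge0 ltW// norm_gt0.
rewrite (integral_gamma_kerZ _ _ _ _ _ (fun p => `|p.1 - p.2|%:E)); first last.
- by move=> p; rewrite lee_fin.
- exact/measurable_EFinP.
- exact: C0.
- exact: C0.
rewrite (gamma_ker_homogeneous _ _ _ 1 (fun p => `|p.1 - p.2|)); first last.
- by move=> z p z0; rewrite -mulrBr normrM gtr0_norm.
- by [].
- exact: mw.
rewrite [X in (_ * (X * _))%E](_ : _ = (2 / (a * 4 `^ a))%:E); last first.
  rewrite -(beta_abs_difference a a0); apply: eq_integral => u _.
  by congr (_ * `|_|)%:E; rewrite /=; ring.
rewrite (gamma_massE _ _ lam0 aa10) (GammaS _ aa0) -!EFinM.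
congr EFin.
(* Duplication trades the Beta value of the statement for [Beta a a], after which only powers,
   [Gamma a] and [Gamma (a + a)] remain and the identity is rational. *)
have -> : Beta (1 / 2) a = 4 `^ a * Beta a a / 2.
  by rewrite (Beta_duplication a a0) mulrAC divff ?mul1r.
rewrite BetaE !powRD ?(gt_eqF lam0) ?implybT// powRr1 ?(ltW lam0)//.
move: (powR_gt0 a lam0) (powR_gt0 a (ltr0n R 4 : 0 < 4)) (Gamma_gt0 _ a0) (Gamma_gt0 _ aa0).
move: (lam `^ a) (4 `^ a) (Gamma (a + a)) (Gamma a) => la fa gaa ga la0 fa0 ga0 gaa0.
by field; rewrite !gt_eqF.
Qed.

Lemma gamma_dens_sqr_difference lam a : 0 < lam -> 0 < a ->
  (\int[mu]_x \int[mu]_y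
     ((gamma_dens lam a x * gamma_dens lam a y)%:E * ((x - y) ^+ 2)%:E) =
   (2 * a * lam ^+ 2)%:E)%E.
Proof.
move=> lam0 a0; have aa0 : 0 < a + a by rewrite addr_gt0.
have aa10 : 0 < a + a + 1 by rewrite addr_gt0.
have aa20 : 0 < a + a + 1 + 1 by rewrite addr_gt0.
have mw : measurable_fun [set: R * R] (fun p : R * R => (p.1 - p.2) ^+ 2).
  by apply: measurable_funX; exact: measurable_funB.
have C0 : 0 <= (lam `^ a * Gamma a)^-1 by rewrite invr_ge0 ltW// norm_gt0.
rewrite (integral_gamma_kerZ _ _ _ _ _ (fun p => ((p.1 - p.2) ^+ 2)%:E)); first last.
- by move=> p; rewrite lee_fin sqr_ge0.
- exact/measurable_EFinP.
- exact: C0.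
- exact: C0.
rewrite (gamma_ker_homogeneous _ _ _ 2 (fun p => (p.1 - p.2) ^+ 2)); first last.
- by move=> z p z0; rewrite -mulrBr exprMn.
- by move=> p; rewrite sqr_ge0.
- exact: mw.
rewrite [X in (_ * (X * _))%E](_ : _ = (Beta a a - 4 * Beta (a + 1) (a + 1))%:E); last first.
  rewrite -(beta_sqr_difference a a0); apply: eq_integral => u _.
  by congr (_ * _ ^+ 2)%:E; rewrite /=; ring.
have -> : a + a + 2%:R = a + a + 1 + 1 by ring.
rewrite (gamma_massE _ _ lam0 aa20) -!EFinM; congr EFin.
rewrite !BetaE.
have -> : a + 1 + (a + 1) = a + a + 1 + 1 by ring.
(* By the recurrence the difference of the Beta values is [Beta a a / (2 a + 1)], and [2 a + 1]
   cancels against the leading factor of [Gamma (2 a + 2)]. *)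
rewrite (GammaS _ aa10) (GammaS _ aa0) (GammaS _ a0).
rewrite !powRD ?(gt_eqF lam0) ?implybT// powRr1 ?(ltW lam0)//.
move: (powR_gt0 a lam0) (Gamma_gt0 _ a0) (Gamma_gt0 _ aa0).
move: (lam `^ a) (Gamma (a + a)) (Gamma a) => la gaa ga la0 ga0 gaa0.
by field; rewrite !gt_eqF.
Qed.

End gamma_density.

(** * Integration against a density, and joint laws from independence *)

Section laws_with_densities.
Context {R : realType}.
Local Notation mu := (@lebesgue_measure R).
Import HBNNSimple.

Lemma ge0_integral_density (m : {measure set R -> \bar R}) (p : R -> R) (h : R -> \bar R) :
  measurable_fun [set: R] p -> (forall x, 0 <= p x) ->
  (forall A, measurable A -> m A = \int[mu]_(x in A) (p x)%:E)%E ->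
  measurable_fun [set: R] h -> (forall x, 0 <= h x)%E ->
  (\int[m]_x h x = \int[mu]_x (h x * (p x)%:E))%E.
Proof.
move=> mp p0 mE mh h0.
pose h_ := nnsfun_approx measurableT mh.
have hcvg x : EFin \o h_^~ x @ \oo --> h x by exact: cvg_nnsfun_approx.
have ndh x : nondecreasing_seq (h_^~ x) by move=> i j ij; exact/lefP/nd_nnsfun_approx.
transitivity (limn (fun n => \int[m]_x (h_ n x)%:E))%E.
  rewrite -monotone_convergence//.
  - by apply: eq_integral => x _; apply/esym/cvg_lim => //; exact: hcvg.
  - by move=> n; exact/measurable_EFinP/measurable_funP.
  - by move=> n x _; rewrite lee_fin.
  - by move=> x _ i j ij; rewrite lee_fin; exact: ndh.
have mhp n : measurable_fun [set: R] (fun x => (h_ n x * p x)%:E).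
  by apply/measurable_EFinP/measurable_funM => //; exact/measurable_funP.
transitivity (limn (fun n => \int[mu]_x (h_ n x * p x)%:E))%E; last first.
  rewrite -monotone_convergence//.
  - apply: eq_integral => x _; apply/cvg_lim => //.
    under eq_fun do rewrite EFinM.
    by apply: cvgeZr => //; exact: hcvg.
  - by move=> n x _; rewrite lee_fin mulr_ge0.
  - by move=> x _ i j ij; rewrite lee_fin ler_wpM2r//; exact: ndh.
congr (limn _); apply/funext => n.
rewrite integralT_nnsfun sintegralE.
transitivity (\sum_(k \in range (h_ n))
    \int[mu]_x (k * \1_(h_ n @^-1` [set k]) x * p x)%:E)%E.
  apply: eq_fsbigr => k /[!inE] -[x _ <-{k}].
  rewrite mE; last exact: (measurable_funPTI (h_ n)).
  rewrite -ge0_integralZl; first last.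
  - by rewrite lee_fin.
  - by move=> y _; rewrite lee_fin.
  - by apply/measurable_EFinP; exact: measurable_funTS.
  - exact: (measurable_funPTI (h_ n)).
  rewrite integral_mkcond; apply: eq_integral => y _.
  rewrite patchE indicE; case: ifP => _; first by rewrite mulr1.
  by rewrite mulr0 mul0r.
rewrite -ge0_integral_fsum//.
- by apply: eq_integral => x _; rewrite [in RHS]fimfunE mulr_fsuml fsumEFin.
- move=> k; apply/measurable_EFinP/measurable_funM => //.
  apply: measurable_funM => //; apply: measurable_indic.
  exact: (measurable_funPTI (h_ n)).
- by move=> k x _; rewrite EFinM mule_ge0 ?nnfun_muleindic_ge0// lee_fin.
Qed.

Context {d} {T : measurableType d} (P : probability T R) (X Y : {RV P >-> R}).

(** Both sides are finite measures in [D] that agree on rectangles: the law of the pair under [P]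
    restricted to [C], and the product law scaled by [P C]. Keeping [C] lets the induction on sums
    work inside an event. *)
Lemma independent_joint_law (C : set T) : measurable C ->
  (forall A B, measurable A -> measurable B ->
    P (C `&` (X @^-1` A `&` Y @^-1` B)) = P C * (P (X @^-1` A) * P (Y @^-1` B)))%E ->
  forall D : set (R * R), measurable D ->
  (P (C `&` (fun w => (X w, Y w)) @^-1` D) =
   P C * (distribution P X \x distribution P Y) D)%E.
Proof.
move=> mC hC D mD.
have mXY : measurable_fun [set: T] (fun w => (X w, Y w)) by exact: measurable_fun_pair.
pose XY : {mfun T >-> (R * R)%type} := HB.pack (fun w => (X w, Y w))
  (isMeasurableFun.Build _ _ _ _ (fun w => (X w, Y w)) mXY).
have PC0 : 0 <= fine (P C) by exact: fine_ge0.
pose k := NngNum PC0.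
have kE : P C = k%:num%:E by rewrite /= fineK// fin_num_measure.
rewrite kE.
have -> : P (C `&` (fun w => (X w, Y w)) @^-1` D) = pushforward (mrestr P mC) XY D.
  by rewrite /pushforward /mrestr setIC.
rewrite -(@product_measure_unique _ _ _ _ R (mscale k (distribution P X))
  (distribution P Y) (pushforward (mrestr P mC) XY))//; last first.
  move=> A B mA mB; transitivity (P C * (P (X @^-1` A) * P (Y @^-1` B)))%E.
    by rewrite -hC// setIC.
  by rewrite kE muleA.
rewrite /product_measure1/= ge0_integral_mscale//.
exact: measurable_fun_xsection.
Qed.

End laws_with_densities.

(** * Expectations and sums for an independent pair with densities *)

Section independent_pairs.
Context {R : realType} {d} {T : measurableType d} (P : probability T R).
Local Notation mu := (@lebesgue_measure R).

Definition has_density (X : T -> R) (p : R -> R) : Prop :=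
  forall A : set R, measurable A -> P (X @^-1` A) = (\int[mu]_(x in A) (p x)%:E)%E.

Lemma integral_product_law (X Y : {RV P >-> R}) (p q : R -> R) (h : R * R -> \bar R) :
  measurable_fun [set: R] p -> measurable_fun [set: R] q ->
  (forall x, 0 <= p x) -> (forall x, 0 <= q x) ->
  has_density X p -> has_density Y q ->
  measurable_fun [set: R * R] h -> (forall z, 0 <= h z)%E ->
  (\int[distribution P X \x distribution P Y]_z h z =
   \int[mu]_x \int[mu]_y ((p x * q y)%:E * h (x, y)))%E.
Proof.
move=> mp mq p0 q0 dX dY mh h0.
rewrite fubini_tonelli1//.
rewrite (ge0_integral_density (distribution P X) p)//; last 2 first.
- exact: measurable_fun_fubini_tonelli_F.
- by move=> x; apply: integral_ge0.
apply: eq_integral => x _; rewrite /fubini_F.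
rewrite (ge0_integral_density (distribution P Y) q)//; last exact: measurable_fun_pair2.
rewrite muleC -ge0_integralZl; first last.
- by rewrite lee_fin.
- by move=> y _; rewrite mule_ge0// lee_fin.
- by apply: emeasurable_funM; [exact: measurable_fun_pair2|exact/measurable_EFinP].
- by [].
by apply: eq_integral => y _; rewrite EFinM -muleA; congr (_ * _)%E; rewrite muleC.
Qed.

Lemma independent_integral (X Y : T -> R) (p q : R -> R) (h : R * R -> \bar R) :
  measurable_fun setT X -> measurable_fun setT Y ->
  measurable_fun [set: R] p -> measurable_fun [set: R] q ->
  (forall x, 0 <= p x) -> (forall x, 0 <= q x) ->
  has_density X p -> has_density Y q ->
  (forall A B, measurable A -> measurable B ->
    P (X @^-1` A `&` Y @^-1` B) = P (X @^-1` A) * P (Y @^-1` B))%E ->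
  measurable_fun [set: R * R] h -> (forall z, 0 <= h z)%E ->
  (\int[P]_w h (X w, Y w) = \int[mu]_x \int[mu]_y ((p x * q y)%:E * h (x, y)))%E.
Proof.
move=> mX mY.
pose X' : {RV P >-> R} := HB.pack X (isMeasurableFun.Build _ _ _ _ X mX).
pose Y' : {RV P >-> R} := HB.pack Y (isMeasurableFun.Build _ _ _ _ Y mY).
move=> mp mq p0 q0 dX dY hXY mh h0.
rewrite -(integral_product_law X' Y')//.
have mXY : measurable_fun [set: T] (fun w => (X w, Y w)) by exact: measurable_fun_pair.
rewrite -[LHS](@ge0_integral_pushforward _ _ _ _ R _ mXY P setT h)//.
apply: eq_measure_integral => D mD _.
have := independent_joint_law P X' Y' setT measurableT _ D mD.
rewrite setTI probability_setT mul1e; apply => A B mA mB.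
by rewrite setTI mul1e; exact: hXY.
Qed.

Lemma sum_law_on_event (C : set T) (X Y : T -> R) (p q : R -> R) (A : set R) :
  measurable_fun setT X -> measurable_fun setT Y ->
  measurable_fun [set: R] p -> measurable_fun [set: R] q ->
  (forall x, 0 <= p x) -> (forall x, 0 <= q x) ->
  has_density X p -> has_density Y q -> measurable C ->
  (forall A B, measurable A -> measurable B ->
    P (C `&` (X @^-1` A `&` Y @^-1` B)) = P C * (P (X @^-1` A) * P (Y @^-1` B)))%E ->
  measurable A ->
  (P (C `&` (fun w => X w + Y w)%R @^-1` A) = P C *
   \int[mu]_x \int[mu]_y ((p x * q y)%:E * (\1_A (x + y)%R)%:E))%E.
Proof.
move=> mX mY.
pose X' : {RV P >-> R} := HB.pack X (isMeasurableFun.Build _ _ _ _ X mX).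
pose Y' : {RV P >-> R} := HB.pack Y (isMeasurableFun.Build _ _ _ _ Y mY).
move=> mp mq p0 q0 dX dY mC hC mA.
have mD : measurable [set z : R * R | A (z.1 + z.2)].
  rewrite -[X in measurable X]setTI.
  by apply: (measurable_funD measurable_fst measurable_snd).
rewrite [LHS](independent_joint_law P X' Y' C mC hC _ mD); congr (_ * _)%E.
rewrite -[X in _ X = _]setIT -integral_indic//.
rewrite (integral_product_law X' Y' p q (fun z => (\1_[set z : R * R | A (z.1 + z.2)] z)%:E))//.
by apply/measurable_EFinP; exact: measurable_indic.
Qed.

End independent_pairs.

(** * Laws and independence of sums over disjoint index lists *)

Section sums_of_independent_gammas.
Context {R : realType} {d} {T : measurableType d} (P : probability T R).
Context {K : finType} (G : K -> T -> R).
Hypothesis mG : forall k, measurable_fun setT (G k).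
Local Notation mu := (@lebesgue_measure R).
Implicit Types (C : set T) (S J : {set K}) (k : K) (l : seq K).

Definition joint_event J (B : K -> set R) : set T :=
  \bigcap_(i in [set` J]) (G i @^-1` B i).

(** For the sure event this is the product rule for the variables indexed by [S]; given that rule,
    it says for general [C] that [C] is independent of them. *)
Definition independent_event C S : Prop :=
  forall J (B : K -> set R), J \subset S -> (forall i, measurable (B i)) ->
    (P (C `&` joint_event J B) =
     P C * (\prod_(i in J) fine (P (G i @^-1` B i)))%:E)%E.

Let measurable_preimage (X : T -> R) (A : set R) :
  measurable_fun setT X -> measurable A -> measurable (X @^-1` A).
Proof. by move=> mX mA; rewrite -[X in measurable X]setTI; exact: mX. Qed.

Lemma measurable_joint_event J B : (forall i, measurable (B i)) ->
  measurable (joint_event J B).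
Proof.
by move=> mB; apply: fin_bigcap_measurable => // i _; exact: measurable_preimage.
Qed.

Lemma joint_eventU1 k J (A : set R) (B : K -> set R) : k \notin J ->
  joint_event (k |: J) (fun i => if i == k then A else B i) =
  G k @^-1` A `&` joint_event J B.
Proof.
move=> kJ; apply/seteqP; split => [w h|w [hk h] i /=].
  split; first by have := h k; rewrite /= !inE eqxx /=; exact.
  move=> i /= iJ; have := h i; rewrite /= !inE iJ orbT => /(_ isT).
  by case: eqP => [ik|//]; rewrite -ik iJ in kJ.
rewrite !inE; case: eqP => [->//|_] /= iJ; exact: h.
Qed.

Lemma prod_joint_eventU1 k J (A : set R) (B : K -> set R) : k \notin J ->
  \prod_(i in k |: J) fine (P (G i @^-1` (if i == k then A else B i))) =
  fine (P (G k @^-1` A)) * \prod_(i in J) fine (P (G i @^-1` B i)).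
Proof.
move=> kJ; rewrite big_setU1//= eqxx; congr (_ * _).
by apply: eq_bigr => i iJ; case: eqP => // ik; rewrite ik (negPf kJ) in iJ.
Qed.

Variables (lam s : R).
Hypotheses (lam0 : 0 < lam) (s0 : 0 < s).
Hypothesis G_density : forall k, has_density P (G k) (gamma_dens lam s).
Hypothesis G_indep : independent_event setT [set: K].

Let measurable_sum l : measurable_fun setT (fun w => \sum_(k <- l) G k w).
Proof. by apply: measurable_sum. Qed.

(* The event [C] and the joint event on [J] record that the partial sum remains
   independent of everything not yet used: this is what the induction consumes,
   and taking [C] in the sigma-algebra of one sum separates two disjoint sums. *)
Lemma gamma_sum_on_event k l C S J (A : set R) (B : K -> set R) :
  uniq (k :: l) -> measurable C -> independent_event C S ->
  (forall i, i \in k :: l -> i \in S) ->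
  J \subset S -> (forall i, i \in k :: l -> i \notin J) ->
  measurable A -> (forall i, measurable (B i)) ->
  (P (C `&` (fun w => \sum_(i <- k :: l) G i w)%R @^-1` A `&` joint_event J B) =
   P C * (\int[mu]_(x in A) (gamma_dens lam (s * (size l).+1%:R) x)%:E) *
   (\prod_(i in J) fine (P (G i @^-1` B i)))%:E)%E.
Proof.
elim: l k C S J A B => [|k' l ih] k C S J A B.
  move=> _ mC iC kS JS kJ mA mB.
  have kJ' : k \notin J by apply: kJ; rewrite inE.
  rewrite mulr1 -(G_density k)//.
  under eq_fun do rewrite big_seq1.
  rewrite -setIA -joint_eventU1// iC; last 2 first.
  - by rewrite finset.subUset finset.sub1set JS kS// inE.
  - by move=> i; case: ifP.
  by rewrite prod_joint_eventU1// EFinM fineK ?fin_num_measure ?muleA//; exact: measurable_preimage.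
move=> kkl mC iC klS JS klJ mA mB.
have kJ : k \notin J by apply: klJ; rewrite inE eqxx.
pose Y w := \sum_(i <- k' :: l) G i w.
have mY : measurable_fun setT Y by exact: measurable_sum.
have ukl : uniq (k' :: l) by case/andP: kkl.
have k_notin : k \notin k' :: l by case/andP: kkl.
(* The induction hypothesis with the sure event and an empty [J] is the unconditional law of the
   tail. *)
have Y_density : has_density P Y (gamma_dens lam (s * (size l).+1%:R)).
  move=> A' mA'.
  have := ih k' setT _ finset.set0 A' (fun=> setT) ukl measurableT G_indep.
  rewrite finset.big_set0 mule1 probability_setT mul1e => <- //; last 2 first.
  - by move=> i _; rewrite inE.
  - by move=> i _; rewrite inE.
  congr (P _); rewrite setTI; apply/seteqP; split => [w h|w []//].
  by split=> // i /=; rewrite inE.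
have s1 : 0 < s * (size l).+1%:R by rewrite mulr_gt0.
(* Merging the joint event on [J] into the conditioning event leaves a statement about the two
   variables [G k] and [Y] only. *)
pose C' := C `&` joint_event J B.
have mC' : measurable C' by apply: measurableI => //; exact: measurable_joint_event.
have -> : C `&` (fun w => \sum_(i <- [:: k, k' & l]) G i w) @^-1` A `&` joint_event J B =
    C' `&` (fun w => G k w + Y w) @^-1` A.
  rewrite -setIA (setIC (_ @^-1` _)) setIA; congr (_ `&` _).
  by rewrite -[in RHS]/(Y _); apply/seteqP; split => w /=; rewrite big_cons.
rewrite (sum_law_on_event P C' (G k) Y
  (gamma_dens lam s) (gamma_dens lam (s * (size l).+1%:R))); first last.
- exact: mA.
- move=> A1 A2 mA1 mA2.
  (* Since [k] does not occur in the tail, the constraint on [G k] can be moved into the joint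
     event; the induction hypothesis then separates it from [Y]. *)
  transitivity (P (C `&` Y @^-1` A2 `&`
      joint_event (k |: J) (fun i => if i == k then A1 else B i))).
    rewrite joint_eventU1//; congr (P _); rewrite /C'.
    by apply/seteqP; split => w /=; tauto.
  rewrite (ih k' C S); first last.
  - by move=> i; case: ifP.
  - exact: mA2.
  - move=> i il; rewrite finset.in_setU1 negb_or; apply/andP; split.
      by apply: contraNneq k_notin => <-.
    by apply: klJ; rewrite inE il orbT.
  - by rewrite finset.subUset finset.sub1set JS klS// inE eqxx.
  - by move=> i il; apply: klS; rewrite inE il orbT.
  - exact: iC.
  - exact: mC.
  - exact: ukl.
  rewrite prod_joint_eventU1// -(Y_density _ mA2) /C' (iC J B JS mB) EFinM.
  rewrite fineK; last by apply: fin_num_measure; exact: measurable_preimage.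
  rewrite -!muleA; congr (_ * _)%E.
  by rewrite muleCA [RHS]muleCA; congr (_ * _)%E; rewrite muleC.
- exact: mC'.
- exact: Y_density.
- exact: G_density.
- by move=> x; exact: gamma_dens_ge0.
- by move=> x; exact: gamma_dens_ge0.
- exact: measurable_gamma_dens.
- exact: measurable_gamma_dens.
- exact: mY.
- exact: mG.
rewrite (gamma_dens_convolution _ _ _ _ lam0 s0 s1 mA) /C' (iC J B JS mB).
have -> : s + s * (size l).+1%:R = s * (size (k' :: l)).+1%:R.
  by rewrite -[in RHS]natr1 mulrDr mulr1 addrC.
by rewrite -!muleA [X in (_ * X = _)%E]muleC.
Qed.

Let joint_event_set0 B : joint_event finset.set0 B = setT.
Proof. by apply/seteqP; split => // w _ i /=; rewrite inE. Qed.

Lemma gamma_sum_density l : uniq l -> (0 < size l)%N ->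
  has_density P (fun w => \sum_(i <- l) G i w) (gamma_dens lam (s * (size l)%:R)).
Proof.
case: l => // k l ukl _ A mA.
have := gamma_sum_on_event k l setT _ finset.set0 A (fun=> setT) ukl measurableT G_indep.
rewrite finset.big_set0 mule1 probability_setT mul1e joint_event_set0 setIT setTI.
by apply => // i _; rewrite inE.
Qed.

(** The event about the first sum is independent of all variables outside [l], so it can serve as
    the conditioning event when the law of the second sum is computed. *)
Lemma gamma_sums_independent l l' (A B : set R) :
  uniq l -> uniq l' -> (0 < size l)%N -> (0 < size l')%N ->
  (forall i, i \in l -> i \notin l') -> measurable A -> measurable B ->
  (P ((fun w => \sum_(i <- l) G i w)%R @^-1` A `&` (fun w => \sum_(i <- l') G i w)%R @^-1` B) =
   P ((fun w => \sum_(i <- l) G i w)%R @^-1` A) *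
   P ((fun w => \sum_(i <- l') G i w)%R @^-1` B))%E.
Proof.
move=> ul ul' l0 l'0 ll' mA mB.
pose C := (fun w => \sum_(i <- l) G i w) @^-1` A.
have mC : measurable C by apply: measurable_preimage => //; exact: measurable_sum.
have iC : independent_event C (finset.finset [pred i | i \notin l]).
  move=> J F /fintype.subsetP JS mF.
  rewrite /C (gamma_sum_density _ ul l0 _ mA).
  case: l ul l0 JS {ll' C mC} => // k l ukl _ JS.
  have := gamma_sum_on_event k l setT _ J A F ukl measurableT G_indep.
  rewrite probability_setT mul1e setTI; apply => //.
  - by move=> i _; rewrite inE.
  - by move=> i; apply: contraTN => /JS; rewrite finset.in_set.
rewrite -/C (gamma_sum_density _ ul' l'0 _ mB).
case: l' ul' l'0 ll' => // k l' ukl _ ll'.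
have := gamma_sum_on_event k l' C _ finset.set0 B (fun=> setT) ukl mC iC.
rewrite finset.big_set0 mule1 joint_event_set0 setIT; apply => //.
- by move=> i; rewrite finset.in_set; apply: contraTN => /ll'.
- by rewrite finset.sub0set.
- by move=> i _; rewrite inE.
Qed.

End sums_of_independent_gammas.

(** * Mean and variance of a scaled absolute difference *)

Section absolute_difference.
Context {R : realType} {d} {T : measurableType d} (P : probability T R).

(** The prescribed density lives on the closed half line and, for shape 1, is nonzero at 0, where
    [gamma_dens] vanishes; the two differ there on a null set only. *)
Lemma gamma_distributed_density (n lam : R) (X : T -> R) : 0 < lam ->
  gamma_distributed P n lam X -> has_density P X (gamma_dens lam (1 / n)).
Proof.
move=> lam0 hX A mA; rewrite hX// integral_mkcondl.
have mpdf : measurable_fun [set: R] (gamma_pdf n lam).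
  apply: measurable_funM; last first.
    apply: measurableT_comp => //; exact: measurable_funM.
  apply: measurable_funM => //.
rewrite -integral_itv_obnd_cbnd; last first.
  apply/measurable_funTS/(measurable_restrictT (fun x => (gamma_pdf n lam x)%:E)) => //.
  by apply/measurable_funTS/measurable_EFinP.
rewrite integral_mkcond [RHS]integral_mkcond; apply: eq_integral => x _.
rewrite !patchE; case: ifPn => x0; last first.
  case: ifP => // _; rewrite /gamma_dens /gamma_ker.
  by move: x0; rewrite mem_setE in_itv/= andbT => /negbTE ->; rewrite mul0r.
case: ifP => // _; move: x0; rewrite mem_setE in_itv/= andbT => x0.
rewrite /gamma_pdf /gamma_dens /gamma_ker x0.
have -> : (1 / lam) `^ (1 / n) = (lam `^ (1 / n))^-1.
  by rewrite [1 / lam]div1r -(powR_inv1 (ltW lam0)) -powRrM mulN1r powRN.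
move: (lam `^ _) (x `^ _) (Gamma _) (expR _) => p q g e.
by congr EFin; rewrite invfM; ring.
Qed.

Variables (U V : T -> R) (lam a c : R).
Hypotheses (lam0 : 0 < lam) (a0 : 0 < a) (c0 : 0 <= c).
Hypotheses (mU : measurable_fun setT U) (mV : measurable_fun setT V).
Hypotheses (dU : has_density P U (gamma_dens lam a)).
Hypotheses (dV : has_density P V (gamma_dens lam a)).
Hypothesis iUV : forall A B, measurable A -> measurable B ->
  (P (U @^-1` A `&` V @^-1` B) = P (U @^-1` A) * P (V @^-1` B))%E.

Let X w := c * `|U w - V w|.

Let mX : measurable_fun setT X.
Proof.
apply: measurable_funM => //; apply: measurableT_comp => //.
exact: measurable_funB.
Qed.

Let integralX : (\int[P]_w (X w)%:E = (c * (2 / Beta (1 / 2) a * lam))%:E)%E.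
Proof.
rewrite EFinM -(gamma_dens_abs_difference _ _ lam0 a0).
rewrite -(independent_integral P U V _ _ (fun p => `|p.1 - p.2|%:E) mU mV); first last.
- by move=> p; rewrite lee_fin.
- apply/measurable_EFinP; apply: measurableT_comp => //; exact: measurable_funB.
- exact: iUV.
- exact: dV.
- exact: dU.
- by move=> x; exact: gamma_dens_ge0.
- by move=> x; exact: gamma_dens_ge0.
- exact: measurable_gamma_dens.
- exact: measurable_gamma_dens.
rewrite -ge0_integralZl; first last.
- by rewrite lee_fin.
- by move=> w _; rewrite lee_fin.
- apply/measurable_EFinP; apply: measurableT_comp => //; exact: measurable_funB.
- by [].
by apply: eq_integral => w _; rewrite -EFinM.
Qed.

Let integralXX : (\int[P]_w (X w * X w)%:E = (c ^+ 2 * (2 * a * lam ^+ 2))%:E)%E.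
Proof.
rewrite EFinM -(gamma_dens_sqr_difference _ _ lam0 a0).
rewrite -(independent_integral P U V _ _ (fun p => ((p.1 - p.2) ^+ 2)%:E) mU mV); first last.
- by move=> p; rewrite lee_fin sqr_ge0.
- apply/measurable_EFinP; apply: measurable_funX; exact: measurable_funB.
- exact: iUV.
- exact: dV.
- exact: dU.
- by move=> x; exact: gamma_dens_ge0.
- by move=> x; exact: gamma_dens_ge0.
- exact: measurable_gamma_dens.
- exact: measurable_gamma_dens.
rewrite -ge0_integralZl; first last.
- by rewrite lee_fin sqr_ge0.
- by move=> w _; rewrite lee_fin sqr_ge0.
- apply/measurable_EFinP; apply: measurable_funX; exact: measurable_funB.
- by [].
apply: eq_integral => w _; rewrite -EFinM /X; congr EFin.
by rewrite -expr2 exprMn real_normK ?num_real.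
Qed.

Lemma expectation_abs_difference :
  ('E_P[X] = (c * (2 / Beta (1 / 2) a * lam))%:E)%E.
Proof. by rewrite unlock. Qed.

Lemma variance_abs_difference :
  ('V_P[X] = ((2 * a - 4 / Beta (1 / 2) a ^+ 2) * (lam * c) ^+ 2)%:E)%E.
Proof.
have X0 w : 0 <= X w by rewrite mulr_ge0.
have X1 : X \in Lfun P 1.
  apply/Lfun1_integrable/integrableP; split; first exact/measurable_EFinP.
  under eq_integral do rewrite gee0_abs ?lee_fin//.
  by rewrite integralX ltry.
have X2 : (X * X)%R \in Lfun P 1.
  apply/Lfun1_integrable/integrableP; split; first exact/measurable_EFinP/measurable_funM.
  under eq_integral do rewrite gee0_abs ?lee_fin ?mulr_ge0//.
  by rewrite integralXX ltry.
rewrite /variance (covarianceE X1 X1 X2) expectation_abs_difference.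
have -> : ('E_P[X * X] = (c ^+ 2 * (2 * a * lam ^+ 2))%:E)%E by rewrite -integralXX unlock.
have B0 := Beta_gt0 _ _ (divr_gt0 ltr01 (ltr0n R 2 : 0 < 2)) a0.
rewrite -EFinM -EFinB; congr EFin.
move: (Beta _ _) B0 => B B0.
by field; rewrite gt_eqF.
Qed.

End absolute_difference.

Theorem theorem2 (d : measure_display) (T : measurableType d) (R : realType)
  (P : probability T R) (N M : nat) (lam : R)
  (X : 'I_N -> R) (G : 'I_N * bool -> T -> R) :
  (1 <= N)%N -> (M < N)%N -> 0 < lam ->
  0 <= \sum_(i < N) X i ->
  (forall k, measurable_fun setT (G k)) ->
  mutually_independent P G ->
  (forall k, gamma_distributed P (N - M)%:R lam (G k)) ->
  let Xsum := \sum_(i < N) X i in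
  let Xhat := fun i w => X i + G (i, true) w - G (i, false) w in
  let Xhatsum := fun w => \sum_(i < N) Xhat i w in
  let delta := fun w => `|Xsum - Xhatsum w| / (Xsum + 1) in
  let alpha := M%:R / N%:R : R in
  ('E_P[delta] <= (2 / Beta (1 / 2) (1 / (1 - alpha)) * (lam / (Xsum + 1)))%:E)%E /\
  'V_P[delta] \is a fin_num /\
  Num.sqrt (fine 'V_P[delta]) <=
    Num.sqrt (2 / (1 - alpha) - 4 / (Beta (1 / 2) (1 / (1 - alpha))) ^+ 2)
      * (lam / (Xsum + 1)).
Proof.
move=> N1 MN lam0 Xsum0 mG iG dG Xsum Xhat Xhatsum delta alpha.
have NM0 : 0 < (N - M)%:R :> R by rewrite ltr0n subn_gt0.
have N0 : 0 < N%:R :> R by rewrite ltr0n.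
pose a : R := 1 / (1 - alpha).
(* Each noise term has shape [1 / (N - M)] and [N] of them are added, which gives the shape
   [1 / (1 - alpha)] of both sums. *)
have aE : a = 1 / (N - M)%:R * N%:R.
  have NM0' : 0 < N%:R - M%:R :> R by rewrite subr_gt0 ltr_nat.
  by rewrite /a /alpha natrB ?(ltnW MN)//; field; rewrite !gt_eqF.
have a0 : 0 < a by rewrite aE mulr_gt0// divr_gt0.
pose c : R := (Xsum + 1)^-1.
have c0 : 0 <= c by rewrite invr_ge0 addr_ge0.
have s0 : 0 < 1 / (N - M)%:R :> R by rewrite divr_gt0.
have G_density k : has_density P (G k) (gamma_dens lam (1 / (N - M)%:R)).
  exact: gamma_distributed_density.
have G_indep : independent_event P G setT (finset.setTfor _).
  move=> J B _ mB.
  rewrite setTI probability_setT mul1e -(iG J B mB) fineK//.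
  apply: fin_num_measure; exact: measurable_joint_event.
(* The flag [b] selects the added or the subtracted noise; the two index lists are duplicate-free
   and disjoint, as the independence of the sums requires. *)
pose users b : seq ('I_N * bool) := [seq (i, b) | i <- enum 'I_N].
have users_uniq b : uniq (users b).
  by rewrite map_inj_uniq ?enum_uniq// => i j [].
have users_size b : size (users b) = N by rewrite size_map size_enum_ord.
have users0 b : (0 < size (users b))%N by rewrite users_size.
pose U b w := \sum_(k <- users b) G k w.
have mU b : measurable_fun setT (U b) by exact: measurable_sum.
have U_density b : has_density P (U b) (gamma_dens lam a).
  have := gamma_sum_density P G mG lam _ lam0 s0 G_density G_indep
    (users b) (users_uniq b) (users0 b).
  by rewrite users_size -aE.
have U_indep A B : measurable A -> measurable B ->
    (P (U true @^-1` A `&` U false @^-1` B) = P (U true @^-1` A) * P (U false @^-1` B))%E.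
  move=> mA mB; apply: (gamma_sums_independent P G mG lam _ lam0 s0 G_density G_indep) => //.
  by move=> k /mapP[i _ ->]; apply/mapP => -[j _ []].
have deltaE : delta = (fun w => c * `|U true w - U false w|).
  apply/funext => w; rewrite /delta mulrC; congr (_ * _).
  rewrite /Xhatsum /Xhat distrC; congr `|_|.
  have UE b : U b w = \sum_(i < N) G (i, b) w by rewrite /U big_map big_enum.
  by rewrite !UE -!sumrB; apply: eq_bigr => i _; ring.
have expE := expectation_abs_difference P _ _ _ _ _ lam0 a0 c0 (mU true) (mU false)
  (U_density true) (U_density false) U_indep.
have varE := variance_abs_difference P _ _ _ _ _ lam0 a0 c0 (mU true) (mU false)
  (U_density true) (U_density false) U_indep.
rewrite -/a deltaE expE varE; split; last split => //.
  by rewrite lee_fin le_eqVlt; apply/orP; left; apply/eqP; rewrite /c; ring.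
have -> : 2 / (1 - alpha) = 2 * a by rewrite /a mul1r.
(* The square [(lam * c) ^+ 2] is moved to the front because [sqrtrM] asks for a nonnegative first
   factor. *)
rewrite [fine _]/= mulrC sqrtrM ?sqr_ge0// sqrtr_sqr mulrC ger0_norm//.
by rewrite mulr_ge0// ltW.
Qed.
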